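(* Let $G=(V,E)$ be a connected undirected graph on $n$ nodes with minimum nodal degree $\delta$, let $N_i$ denote the set of neighbours of node $i$, let $K>0$, and let $\bar w_1,\dots,\bar w_n\in\mathbb{R}$ satisfy $\sum_i\bar w_i=0$. Consider solutions $\vec\phi^t\in\mathbb{R}^n$, $t\ge0$, of $$\dot\phi_i=\bar w_i+\frac{K}{n}\sum_{k\in N_i}\sin(\phi_k-\phi_i),\qquad i=1,\dots,n,$$ with initial phases satisfying $\sum_{i=1}^n\phi_i^0=0$. Let $D_0=\max_i\phi_i^0-\min_i\phi_i^0$, $\mathcal{E}_0=\sum_{i=1}^n(\phi_i^0)^2$, $\sigma(\bar w)=\sqrt{\sum_{i=1}^n\bar w_i^2}$, and $$L=\frac{1}{1+\sum_{(k,l)\in E^c}\mathrm{dist}(k,l)},$$ where $E^c$ is the set of unordered pairs of distinct nodes that are not edges of $G$, and $\mathrm{dist}(k,l)$ is the number of edges in a shortest path between $k$ and $l$ in $G$. Suppose $D$ is a constant with $0<D_0\le D\le\frac{\pi}{2}$, that $\mathcal{E}_0<\frac34 D^2$, that $$K\ge\frac{\sigma(\bar w)\, D}{\sqrt{\mathcal{E}_0}\,L\,\sin D},\qquad(\ast)$$ and that $$K\ge\frac{n\,|\bar w_i-\bar w_j|}{2\delta\,\sin\!\Bigl(\frac D2-\sqrt{\mathcal{E}_0-\frac{D^2}{2}}\Bigr)}\quad\text{for all }1\le i,j\le n.$$ Then $D_t:=\max_i\phi_i^t-\min_i\phi_i^t\le D$ for all $t\ge0$ (so the set $\{\vec\phi\in\mathbb{R}^n:\max_{i,j}|\phi_i-\phi_j|\le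 D,\ \sum_i\phi_i=0\}$ is positively invariant for this solution), and the system achieves frequency synchronization, i.e. the solution approaches the set $\{\vec\phi:\dot\phi_i=0,\ 1\le i\le n\}$. Moreover, when $\mathcal{E}_0<\frac{D^2}{2}$, the same conclusion holds assuming only condition $(\ast)$ on $K$ (together with $0<D_0\le D\le\frac\pi2$).
   Context: This is the Kuramoto model in a frame rotating with the mean natural frequency: $\bar w_i=w_i-\frac1n\sum_k w_k$. Along solutions $\sum_i\phi_i^t$ is constant, hence $0$ for all $t$. Frequency synchronization means convergence of the solution to the set of equilibria of this system. *)

(* Defs.v *)
From HB Require Import structures.
From mathcomp Require Import all_boot all_order all_algebra.
From mathcomp Require Import all_classical all_reals all_analysis.
Set Implicit Arguments. Unset Strict Implicit. Unset Printing Implicit Defensive.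
Import Order.TTheory GRing.Theory Num.Theory.
Import numFieldNormedType.Exports.
Local Open Scope classical_set_scope.
Local Open Scope ring_scope.

Definition simple_graph n (e : rel 'I_n) : Prop :=
  symmetric e /\ irreflexive e.

Definition connected_graph n (e : rel 'I_n) : Prop :=
  forall i j : 'I_n, connect e i j.

Definition degree n (e : rel 'I_n) (i : 'I_n) : nat := #|[set j | e i j]|.
Definition min_degree n (e : rel 'I_n) : nat :=
  \big[minn/n]_(i : 'I_n) degree e i.

Definition walk_of_len n (e : rel 'I_n) (k l : 'I_n) (m : nat) : bool :=
  [exists p : m.-tuple 'I_n, path e k p && (last k p == l)].

(* graph distance: the least m such that a walk with m edges from k to l
   exists (such walks of minimal length are shortest paths); the search is
   over m < n, which suffices in a connected graph on n nodes (value n if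
   l is unreachable). *)
Definition gdist n (e : rel 'I_n) (k l : 'I_n) : nat :=
  find (walk_of_len e k l) (iota 0 n).

Definition L_const (R : realType) n (e : rel 'I_n) : R :=
  1 / (1 + \sum_(k : 'I_n) \sum_(l : 'I_n | (k < l)%N && ~~ e k l)
             (gdist e k l)%:R).

Definition kuramoto_rhs (R : realType) n (e : rel 'I_n) (K : R)
    (w : 'I_n -> R) (phi : 'I_n -> R) (i : 'I_n) : R :=
  w i + K / n%:R * \sum_(k : 'I_n | e i k) sin (phi k - phi i).

(* max_i x_i - min_i x_i = max_{i,j} (x_i - x_j) *)
Definition spread (R : realType) n (x : 'I_n -> R) : R :=
  \big[Num.max/0]_(i : 'I_n) \big[Num.max/0]_(j : 'I_n) (x i - x j).

Definition is_solution (R : realType) n (e : rel 'I_n) (K : R)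
    (w : 'I_n -> R) (phi : R -> 'I_n -> R) : Prop :=
  (forall i : 'I_n, (fun s => phi s i) x @[x --> (0:R)^'+] --> phi 0 i) /\
  (forall (t : R) (i : 'I_n), 0 < t ->
     is_derive t 1 (fun s => phi s i) (kuramoto_rhs e K w (phi t) i)).

Definition equilibria (R : realType) n (e : rel 'I_n) (K : R)
    (w : 'I_n -> R) : set ('I_n -> R) :=
  [set psi | forall i, kuramoto_rhs e K w psi i = 0].

Definition approaches (R : realType) n (phi : R -> 'I_n -> R)
    (S : set ('I_n -> R)) : Prop :=
  forall eps : R, 0 < eps -> exists T : R, forall t, T <= t ->
    exists2 psi, S psi & forall i, `|phi t i - psi i| < eps.

(* Main.v *)
(** Let S be the convex set of phases y with zero mean, spread at most D and
    energy sum y_i^2 at most E0. On the part of its boundary where the energy is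
    E0, the velocity field does not increase the energy: Cauchy-Schwarz bounds
    the drift by sigma sqrt(E0), while sin x >= x sin D / D and the
    path-counting estimate of the edge energy by L bound the dissipation.
    Where y_i - y_j = D, the energy bound keeps the neighbours of i and j close
    enough to the midpoint of y_i and y_j for the coupling to beat w_i - w_j
    (and is contradictory if E0 < D^2 / 2). Both inequalities may be equalities,
    so the invariance of S is obtained by comparison with the slightly growing
    sets (1 + eps exp(M t)) S. The system being a gradient flow, a bounded
    solution has velocity tending to 0, hence approaches the equilibria by
    compactness. *)

Require Import Defs.
From HB Require Import structures.
From mathcomp Require Import all_boot all_order all_algebra.
From mathcomp Require Import all_classical all_reals all_analysis.
From mathcomp Require Import ring lra.
Import Order.TTheory GRing.Theory Num.Theory.
Import numFieldNormedType.Exports.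
Local Open Scope ring_scope.
Set Implicit Arguments.
Unset Strict Implicit.
Unset Printing Implicit Defensive.

(** * Trigonometric inequalities *)

Lemma ler_sin (R : realType) :
  {in `[- (pi / 2), pi / 2 : R] &, {mono sin : x y / x <= y}}.
Proof. by apply: le_mono_in => x y xp yp; rewrite ltr_sin. Qed.

Lemma sin_MVT (R : realType) (a b : R) : a < b ->
  exists2 c, a < c < b & sin b - sin a = cos c * (b - a).
Proof.
move=> ab; have [|c] := @MVT R sin cos a b ab (fun x _ => is_derive_sin x).
  by apply: continuous_subspaceT => x; exact: continuous_sin.
by rewrite in_itv /= => cab ->; exists c.
Qed.

(** The mean value theorem gives sin x = x cos c with 0 < c < x, and the cosine decreases on
    [0, pi]. *)
Lemma sin_ge_mul_cos (R : realType) (x : R) :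
  0 <= x -> x <= pi -> x * cos x <= sin x.
Proof.
rewrite le_eqVlt => /predU1P[<-|x0] xpi; first by rewrite sin0 mul0r.
have [c /andP[c0 cx]] := sin_MVT x0; rewrite sin0 !subr0 => ->.
rewrite mulrC ler_wpM2r ?(ltW x0)// ltW// ltr_cos ?in_itv /= ?(ltW x0)//.
by rewrite ltW//= (le_trans (ltW cx)).
Qed.

Lemma norm_sinB (R : realType) (x y : R) : `|sin x - sin y| <= `|x - y|.
Proof.
wlog xy : x y / x < y.
  move=> h; have [xy|xy|->] := ltgtP x y; first exact: h.
    by rewrite distrC [leRHS]distrC; exact: h.
  by rewrite !subrr.
have [c _] := sin_MVT xy; rewrite distrC => ->.
rewrite normrM [leRHS]distrC ler_piMl// ler_norml.
by rewrite cos_geN1 cos_le1.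
Qed.

(** Concavity of the sine on [0, pi / 2]: its mean slope over [0, x] is at least its mean slope over
    [x, D]. *)
Lemma sin_chord (R : realType) (x D : R) :
  0 <= x -> x <= D -> D <= pi / 2 -> x * sin D <= D * sin x.
Proof.
rewrite le_eqVlt => /predU1P[<-|x0]; first by rewrite sin0 mul0r mulr0.
rewrite le_eqVlt => /predU1P[->//|xD] Dp.
have [c /andP[c0 cx]] := sin_MVT x0; have [d /andP[xd dD]] := sin_MVT xD.
rewrite sin0 !subr0 => Ed Ec.
have cd : cos d <= cos c.
  have hp := pi_gt0 R.
  rewrite ltW// ltr_cos ?in_itv /= ?(lt_trans cx)//; lra.
have -> : sin D = sin x + cos d * (D - x) by rewrite -Ed; ring.
rewrite Ec; have : 0 <= (cos c - cos d) * (x * (D - x)).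
  by rewrite mulr_ge0 ?subr_ge0// mulr_ge0 ?subr_ge0// ltW.
lra.
Qed.

Lemma mul_sin_ge (R : realType) (x D : R) :
  `|x| <= D -> D <= pi / 2 -> x ^+ 2 * sin D <= D * (x * sin x).
Proof.
wlog x0 : x / 0 <= x.
  move=> h; have [x0|x0] := leP 0 x; first exact: h.
  rewrite -normrN => xD Dp; have := h (- x) _ xD Dp.
  by rewrite oppr_ge0 sqrrN sinN mulrNN; apply; exact: ltW.
rewrite ger0_norm// => xD Dp; have := sin_chord x0 xD Dp.
rewrite -subr_ge0 => h; rewrite -subr_ge0.
have -> : D * (x * sin x) - x ^+ 2 * sin D = x * (D * sin x - x * sin D) by ring.
exact: mulr_ge0.
Qed.

Lemma cosB_sinM (R : realType) (p q : R) :
  cos (p - q) - cos (p + q) = 2 * (sin p * sin q).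
Proof. by rewrite cosB cosD; ring. Qed.

Lemma cos_ge_quadratic (R : realType) (u : R) : 1 - u ^+ 2 / 2 <= cos u.
Proof.
have := cosB_sinM (u / 2) (u / 2); rewrite subrr cos0 -splitr => h.
suff : sin (u / 2) * sin (u / 2) <= u ^+ 2 / 4 by lra.
have := norm_sinB (u / 2) 0; rewrite sin0 !subr0 -(ler_pXn2r (_ : 0 < 2)%N) ?nnegrE//.
by rewrite !real_normK ?num_real//; lra.
Qed.

Lemma cos_sqr_ge_half (R : realType) (p : R) :
  0 <= p -> p <= pi / 4 -> 1 / 2 <= cos p ^+ 2.
Proof.
move=> p0 pp; have hp := pi_gt0 R.
have : 0 <= cos (p + p) by apply: cos_ge0_pihalf; lra.
by have := cos2Dsin2 p; rewrite cosD; lra.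
Qed.

(** Multiply sin p >= p cos p by the same bound for q; up to pi / 4 each cosine is at least 1 / sqrt
    2. *)
Lemma sinM_ge_half (R : realType) (p q : R) :
  0 <= p -> p <= pi / 4 -> 0 <= q -> q <= pi / 4 ->
  p * q / 2 <= sin p * sin q.
Proof.
move=> p0 pp q0 qp; have hp := pi_gt0 R.
have cp : 0 <= cos p by apply: cos_ge0_pihalf; lra.
have cq : 0 <= cos q by apply: cos_ge0_pihalf; lra.
have h1 := cos_sqr_ge_half p0 pp; have h2 := cos_sqr_ge_half q0 qp.
have h3 : 1 / 2 <= cos p * cos q.
  rewrite -(ler_pXn2r (_ : 0 < 2)%N) ?nnegrE ?mulr_ge0//.
  have half : 0 <= 1 / 2 :> R by lra.
  by rewrite exprMn; have := ler_pM half half h1 h2; lra.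
have h4 : (p * cos p) * (q * cos q) <= sin p * sin q.
  by apply: ler_pM; rewrite ?mulr_ge0// sin_ge_mul_cos//; lra.
apply: le_trans h4.
have -> : p * cos p * (q * cos q) = (p * q) * (cos p * cos q) by ring.
by have := ler_wpM2l (mulr_ge0 p0 q0) h3; lra.
Qed.

Lemma sinDsin (R : realType) (x y : R) :
  sin x + sin y = 2 * (sin ((x + y) / 2) * cos ((x - y) / 2)).
Proof.
have := sinD ((x + y) / 2) ((x - y) / 2); have := sinB ((x + y) / 2) ((x - y) / 2).
have -> : (x + y) / 2 - (x - y) / 2 = y by field.
have -> : (x + y) / 2 + (x - y) / 2 = x by field.
by move=> -> ->; ring.
Qed.

(** The gap cos v - cos s = 2 sin ((s + v) / 2) sin ((s - v) / 2) is at least (s^2 - v^2) / 4 >= u^2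
    / 2, which covers the loss (1 - cos u) cos v. *)
Lemma cosM_ge (R : realType) (u v s : R) : 0 <= s -> s <= pi / 4 ->
  2 * u ^+ 2 + v ^+ 2 <= s ^+ 2 -> cos s <= cos u * cos v.
Proof.
wlog v0 : v / 0 <= v.
  move=> h s0 sp uvs; have [v0|v0] := leP 0 v; first exact: h.
  by rewrite -[cos v]cosN h ?sqrrN// oppr_ge0 ltW.
move=> s0 sp uvs; have hp := pi_gt0 R.
have vs : v <= s.
  by rewrite -(ler_pXn2r (_ : 0 < 2)%N) ?nnegrE//; have := sqr_ge0 u; lra.
have cv : 0 <= cos v by apply: cos_ge0_pihalf; lra.
have cu := cos_ge_quadratic u.
have h : (s + v) / 2 * ((s - v) / 2) / 2 <= sin ((s + v) / 2) * sin ((s - v) / 2).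
  by apply: sinM_ge_half; lra.
have := cosB_sinM ((s + v) / 2) ((s - v) / 2).
have -> : (s + v) / 2 - (s - v) / 2 = v by field.
have -> : (s + v) / 2 + (s - v) / 2 = s by field.
move=> h2.
have h3 : (1 - u ^+ 2 / 2) * cos v <= cos u * cos v by rewrite ler_wpM2r.
have h4 : u ^+ 2 * cos v <= u ^+ 2 by rewrite ler_piMr ?sqr_ge0// cos_le1.
have h5 : (s + v) / 2 * ((s - v) / 2) / 2 = (s ^+ 2 - v ^+ 2) / 8 by field.
lra.
Qed.

(** By the subtraction formula, with nonnegative weights sin (D / 2) and cos (D / 2), it suffices
    that cos s <= cos u cos v and sin u cos v <= sin s. *)
Lemma sin_lower_distinct (R : realType) (D s u v : R) :
  0 <= s -> s <= D / 2 -> D <= pi / 2 -> 2 * u ^+ 2 + v ^+ 2 <= s ^+ 2 ->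
  sin (D / 2 - s) <= sin (D / 2 - u) * cos v.
Proof.
move=> s0 sD Dp uvs; have hp := pi_gt0 R.
have c1 : cos s <= cos u * cos v by apply: cosM_ge => //; lra.
have sD0 : 0 <= sin (D / 2) by apply: sin_ge0_pi; lra.
have cD0 : 0 <= cos (D / 2) by apply: cos_ge0_pihalf; lra.
have us : - s <= u <= s.
  rewrite -ler_norml -(ler_pXn2r (_ : 0 < 2)%N) ?nnegrE//.
  by rewrite real_normK ?num_real//; have := sqr_ge0 u; have := sqr_ge0 v; lra.
have vs : - s <= v <= s.
  rewrite -ler_norml -(ler_pXn2r (_ : 0 < 2)%N) ?nnegrE//.
  by rewrite real_normK ?num_real//; have := sqr_ge0 u; have := sqr_ge0 v; lra.
have cv : 0 <= cos v by apply: cos_ge0_pihalf; lra.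
have ss : 0 <= sin s by apply: sin_ge0_pi; lra.
have c2 : sin u * cos v <= sin s.
  have [u0|u0] := leP 0 u.
    have su : 0 <= sin u by apply: sin_ge0_pi; lra.
    apply: (@le_trans _ _ (sin u)); first by rewrite ler_piMr// cos_le1.
    by rewrite ler_sin ?in_itv /=; lra.
  apply: le_trans ss; rewrite mulr_le0_ge0//.
  by rewrite -[u]opprK sinN oppr_le0; apply: sin_ge0_pi; lra.
rewrite !sinB.
have := ler_wpM2l sD0 c1; have := ler_wpM2l cD0 c2; lra.
Qed.

(** Since sin (D / 2) <= cos (D / 2), it suffices that cos s - cos v <= sin s. The left side is at
    most (1 - s^2 / 4) - (1 - 3 s^2 / 4) = s^2 / 2, and s <= pi / 4 < 1 gives s^2 / 2 <= s / 2 <= s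
    cos s <= sin s. *)
Lemma sin_lower_common (R : realType) (D s v : R) :
  0 <= s -> s <= D / 2 -> D <= pi / 2 -> 2 / 3 * v ^+ 2 <= s ^+ 2 ->
  sin (D / 2 - s) <= sin (D / 2) * cos v.
Proof.
move=> s0 sD Dp vs; have hp := pi_gt0 R.
have hp2 := pihalf_lt2 R.
have sD0 : 0 <= sin (D / 2) by apply: sin_ge0_pi; lra.
have cs : 0 <= cos s by apply: cos_ge0_pihalf; lra.
have ss : 0 <= sin s by apply: sin_ge0_pi; lra.
have sc : sin (D / 2) <= cos (D / 2).
  have -> : cos (D / 2) = sin (pi / 2 - D / 2).
    by rewrite sinB sin_pihalf cos_pihalf; ring.
  by rewrite ler_sin ?in_itv /=; lra.
suff h : cos s - cos v <= sin s.
  by rewrite sinB; have := ler_wpM2l sD0 h; have := ler_wpM2r ss sc; lra.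
have h1 := cos_ge_quadratic v.
have h2 := sin_ge_mul_cos s0 (_ : s <= pi).
have h3 : s * cos s <= sin s by apply: h2; lra.
have h4 : cos s ^+ 2 <= cos s by rewrite expr2 ler_piMr// cos_le1.
have h5 : 1 / 2 <= cos s ^+ 2 by apply: cos_sqr_ge_half; lra.
have h6 : s / 2 <= s * cos s by have := ler_wpM2l s0 (le_trans h5 h4); lra.
have h7 : cos s <= 1 - s ^+ 2 / 4.
  have := cosB_sinM (s / 2) (s / 2); rewrite subrr cos0 -splitr.
  have : s / 2 * (s / 2) / 2 <= sin (s / 2) * sin (s / 2).
    by apply: sinM_ge_half; lra.
  lra.
have h8 : s ^+ 2 <= s by rewrite expr2 ler_piMr//; lra.
lra.
Qed.

(** * Edge energy of a connected graph *)

Lemma sum_sqr_diff (R : realType) (n : nat) (y : 'I_n -> R) :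
  \sum_(i : 'I_n) y i = 0 ->
  \sum_(k : 'I_n) \sum_(l : 'I_n) (y k - y l) ^+ 2 =
  2 * n%:R * \sum_(i : 'I_n) y i ^+ 2.
Proof.
move=> y0; set S := \sum_(i : 'I_n) y i ^+ 2.
have h k : \sum_(l : 'I_n) (y k - y l) ^+ 2 = n%:R * y k ^+ 2 + S.
  have d l : (y k - y l) ^+ 2 = y k ^+ 2 - (2 * y k) * y l + y l ^+ 2 by ring.
  under eq_bigr do rewrite d.
  rewrite big_split /= sumrB sumr_const card_ord -[_ *+ n]mulr_natl -/S.
  by rewrite -mulr_sumr y0 mulr0 subr0.
under eq_bigr do rewrite h.
rewrite big_split /= -mulr_sumr -/S sumr_const card_ord -[S *+ n]mulr_natl; ring.
Qed.

Lemma sum_symmetric (R : realType) (n : nat) (f : 'I_n -> 'I_n -> R) :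
  (forall i j, f i j = f j i) -> (forall i, f i i = 0) ->
  \sum_(i : 'I_n) \sum_(j : 'I_n) f i j =
  2 * \sum_(i : 'I_n) \sum_(j : 'I_n | (i < j)%N) f i j.
Proof.
move=> fC f0.
have h i : \sum_(j : 'I_n) f i j =
    \sum_(j : 'I_n | (i < j)%N) f i j + \sum_(j : 'I_n | (j < i)%N) f i j.
  rewrite (bigID (fun j : 'I_n => (i < j)%N)) /=; congr (_ + _).
  rewrite (bigD1 i) ?ltnn//= f0 add0r; apply: eq_bigl => j.
  by rewrite -leqNgt [RHS]ltn_neqAle andbC.
under eq_bigr do rewrite h.
rewrite big_split /= [X in _ + X](exchange_big_dep predT) //=.
under [X in _ + X]eq_bigr do under eq_bigr do rewrite fC.
by rewrite mulr_natl mulr2n.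
Qed.

Fixpoint path_energy (R : realType) (n : nat) (y : 'I_n -> R) (x : 'I_n)
    (p : seq 'I_n) : R :=
  if p is z :: q then (y x - y z) ^+ 2 + path_energy y z q else 0.

Lemma path_energy_ge0 (R : realType) (n : nat) (y : 'I_n -> R) x p :
  0 <= path_energy y x p.
Proof. by elim: p x => //= z p IH x; rewrite addr_ge0 ?sqr_ge0. Qed.

(** Cauchy-Schwarz for the telescoping sum of the increments along the path. *)
Lemma sqr_diff_le_path_energy (R : realType) (n : nat) (y : 'I_n -> R) x p :
  (y x - y (last x p)) ^+ 2 <= (size p)%:R * path_energy y x p.
Proof.
elim: p x => [|z p IH] x /=; first by rewrite subrr expr0n mul0r.
have := IH z; have := path_energy_ge0 y z p.
set b := y z - y (last z p); set S := path_energy y z p => S0 bS.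
have -> : y x - y (last z p) = (y x - y z) + b by rewrite /b; ring.
set a := y x - y z; rewrite -natr1; set m : R := (size p)%:R.
have m0 : 0 <= m by rewrite ler0n.
suff : 2 * (a * b) <= m * a ^+ 2 + S by move: bS; rewrite -/m; lra.
(* The inequality comes from (m a - b)^2 >= 0 and b^2 <= m S after multiplication by [m]; an empty
   tail, m = 0, forces b = 0 instead. *)
have [mp|] := ltP 0 m; last first.
  move=> mle; have m00 : m = 0 by apply/eqP; rewrite eq_le mle m0.
  have : b ^+ 2 = 0 by apply/eqP; rewrite eq_le sqr_ge0 andbT; move: bS; rewrite -/m m00 mul0r.
  by move/eqP; rewrite sqrf_eq0 => /eqP ->; rewrite m00; lra.
rewrite -(ler_pM2l mp).
have := sqr_ge0 (m * a - b); move: bS; rewrite -/m; lra.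
Qed.

(** A path without repeated nodes uses each edge at most once, while the double sum runs over
    ordered pairs and meets each edge in both directions; hence the factor 2. *)
Lemma path_energy_le_edges (R : realType) (n : nat) (e : rel 'I_n)
    (y : 'I_n -> R) x p : symmetric e -> path e x p -> uniq (x :: p) ->
  2 * path_energy y x p <=
  \sum_(u : 'I_n) \sum_(v : 'I_n | e u v) (y u - y v) ^+ 2.
Proof.
move=> eC ep up.
(* [W] is the double sum restricted to a list of nodes. Prepending [x] to a path from [z] adds both
   orientations of the edge between [x] and [z], which drives the induction. *)
pose W (s : seq 'I_n) := \sum_(u <- s) \sum_(v <- s | e u v) (y u - y v) ^+ 2.
have W0 (s : seq 'I_n) u : 0 <= \sum_(v <- s | e u v) (y u - y v) ^+ 2.
  by apply: sumr_ge0 => v _; exact: sqr_ge0.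
have pW : 2 * path_energy y x p <= W (x :: p).
  elim: p x ep {up} => [|z p IH] x /=.
    by rewrite mulr0 => _; apply: sumr_ge0 => u _; exact: W0.
  move=> /andP[exz ep]; have h := IH _ ep.
  rewrite /W big_cons.
  have h1 : (y x - y z) ^+ 2 <= \sum_(v <- x :: z :: p | e x v) (y x - y v) ^+ 2.
    rewrite big_cons; case: ifP => _; rewrite big_cons exz.
      by rewrite addrCA lerDl addr_ge0 ?sqr_ge0.
    by rewrite lerDl.
  have h2 : (y x - y z) ^+ 2 + W (z :: p) <=
      \sum_(u <- z :: p) \sum_(v <- x :: z :: p | e u v) (y u - y v) ^+ 2.
    rewrite /W big_cons [leRHS]big_cons addrA lerD//.
      rewrite [leRHS]big_cons eC exz lerD2r.
      by rewrite -[X in _ <= X]sqrrN opprB.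
    apply: ler_sum => u _; rewrite [leRHS]big_cons; case: ifP => // _.
    by rewrite lerDr sqr_ge0.
  lra.
apply: le_trans pW _; move: (x :: p) up => s us; rewrite /W big_uniq//=.
apply: (@le_trans _ _ (\sum_(u in s) \sum_(v | e u v) (y u - y v) ^+ 2)).
  apply: ler_sum => u _; rewrite -big_filter big_uniq ?filter_uniq//=.
  under eq_bigl do rewrite mem_filter.
  rewrite [leRHS](bigID (mem s)) /= lerDl.
  by apply: sumr_ge0 => v _; exact: sqr_ge0.
rewrite [leRHS](bigID (mem s)) /= lerDl.
by apply: sumr_ge0 => u _; apply: sumr_ge0 => v _; exact: sqr_ge0.
Qed.

Lemma uniq_path_gdist (n : nat) (e : rel 'I_n) k l : connected_graph e ->
  exists p, [/\ path e k p, last k p = l, uniq (k :: p) & (size p <= gdist e k l)%N].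
Proof.
move=> ce; case: (boolP (has (walk_of_len e k l) (iota 0 n))) => hw.
  have gn : (gdist e k l < n)%N by move: hw; rewrite has_find size_iota.
  have := nth_find 0 hw; rewrite nth_iota// add0n => /existsP[p /andP[ep /eqP]].
  case/shortenP: ep => p' ep' up' sub' lp'; exists p'; split => //.
  rewrite -[gdist e k l](size_tuple p); apply: uniq_leq_size => //.
  by case/andP: up'.
(* A failed search gives [gdist] its default value [n], which bounds the length of any path without
   repeated nodes. *)
rewrite /gdist (hasNfind hw) size_iota.
have /connectP[p ep lp] := ce k l.
case/shortenP: ep lp => p' ep' up' _ ->; exists p'; split => //.
by have := max_card (mem (k :: p')); rewrite (card_uniqP up') /= card_ord => /ltnW.
Qed.

(** Over all ordered pairs the squared differences sum to 2 n times the energy, as the mean is zero.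
    The adjacent pairs contribute [Q], and each ordered non-adjacent pair at most dist(k, l) Q / 2
    through a short path, so the total is at most Q / L. *)
Lemma edge_energy_ge (R : realType) (n : nat) (e : rel 'I_n) (y : 'I_n -> R) :
  simple_graph e -> connected_graph e -> \sum_(i : 'I_n) y i = 0 ->
  2 * n%:R * L_const R e * \sum_(i : 'I_n) y i ^+ 2 <=
  \sum_(u : 'I_n) \sum_(v : 'I_n | e u v) (y u - y v) ^+ 2.
Proof.
move=> [eC e0] ce y0; set Q := (X in _ <= X).
set S : R := \sum_(k : 'I_n) \sum_(l : 'I_n | (k < l)%N && ~~ e k l) (gdist e k l)%:R.
have S0 : 0 <= S by apply: sumr_ge0 => k _; apply: sumr_ge0 => l _; exact: ler0n.
have Q0 : 0 <= Q by apply: sumr_ge0 => k _; apply: sumr_ge0 => l _; exact: sqr_ge0.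
have d k l : (y k - y l) ^+ 2 <= (gdist e k l)%:R * (Q / 2).
  have [p [ep <- up sp]] := uniq_path_gdist k l ce.
  apply: le_trans (sqr_diff_le_path_energy y k p) _.
  apply: ler_pM; rewrite ?path_energy_ge0 ?ler_nat//.
  by have := path_energy_le_edges y eC ep up; rewrite -/Q; lra.
pose f k l := if e k l then 0 else (y k - y l) ^+ 2.
have fC k l : f k l = f l k by rewrite /f eC; case: ifP => // _; ring.
have f0 k : f k k = 0 by rewrite /f e0 subrr expr0n.
have hf : \sum_k \sum_l f k l <= S * Q.
  suff : \sum_(k : 'I_n) \sum_(l : 'I_n | (k < l)%N) f k l <= S * (Q / 2).
    by rewrite (sum_symmetric fC f0); lra.
  rewrite /S mulr_suml; apply: ler_sum => k _; rewrite mulr_suml big_mkcondr /=.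
  by apply: ler_sum => l _; rewrite /f; case: (e k l) => /=.
have tot : \sum_k \sum_l (y k - y l) ^+ 2 = Q + \sum_k \sum_l f k l.
  rewrite -big_split /=; apply: eq_bigr => k _.
  rewrite (bigID (e k)) /=; congr (_ + _); rewrite big_mkcond /=.
  by apply: eq_bigr => l _; rewrite /f if_neg.
have := sum_sqr_diff y0; rewrite tot => h.
rewrite /L_const -/S div1r mulrAC -h mulrC ler_pdivrMl ?ltr_wpDr//.
by rewrite mulrDl mul1r lerD2l.
Qed.

(** * The velocity field on the boundary of the invariant set *)

Lemma degreeE (n : nat) (e : rel 'I_n) i : degree e i = #|e i|.
Proof.
rewrite /degree; apply: eq_card => k; rewrite unfold_in.
by apply/idP/idP => [/set_mem//|h]; apply/mem_set.
Qed.

Lemma min_degree_le (n : nat) (e : rel 'I_n) i : (min_degree e <= degree e i)%N.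
Proof.
rewrite /min_degree; have : i \in index_enum 'I_n by rewrite mem_index_enum.
elim: (index_enum _) => // j s IH; rewrite inE big_cons geq_min.
by case/predU1P => [->|/IH ->]; rewrite ?leqnn ?orbT.
Qed.

Lemma connected_neighbour (n : nat) (e : rel 'I_n) i : connected_graph e ->
  (1 < n)%N -> exists k, e i k.
Proof.
move=> ce n1; have [j ji] : exists j : 'I_n, j != i.
  have [->|h] := eqVneq i (Ordinal n1); first by exists (Ordinal (ltnW n1)).
  by exists (Ordinal n1); rewrite eq_sym.
have /connectP[[|k p] /=] := ce i j; first by move=> _ ij; rewrite ij eqxx in ji.
by case/andP => ik _ _; exists k.
Qed.

Lemma min_degree_gt0 (n : nat) (e : rel 'I_n) : connected_graph e ->
  (1 < n)%N -> (0 < min_degree e)%N.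
Proof.
move=> ce n1; rewrite /min_degree; elim/big_ind: _ => [|x y|i _].
- exact: ltnW.
- by rewrite leq_min => -> ->.
- have [k ik] := connected_neighbour i ce n1.
  by rewrite degreeE; apply/card_gt0P; exists k.
Qed.

(** Take for [k] the neighbour that minimizes [f]. This reduces the coupling at an extremal node to
    its weakest neighbour. *)
Lemma min_degree_sum (R : realType) (n : nat) (e : rel 'I_n) (i : 'I_n)
    (f : 'I_n -> R) : connected_graph e -> (1 < n)%N ->
  (forall k, e i k -> 0 <= f k) ->
  exists2 k, e i k & (min_degree e)%:R * f k <= \sum_(k : 'I_n | e i k) f k.
Proof.
move=> ce n1 f0; have [k0 ik0] := connected_neighbour i ce n1.
case: (@arg_minP _ _ _ k0 (e i) f ik0) => k ik kmin; exists k => //.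
apply: (@le_trans _ _ ((degree e i)%:R * f k)).
  by rewrite ler_wpM2r ?f0// ler_nat min_degree_le.
rewrite degreeE mulr_natl -sumr_const.
by apply: ler_sum => l /kmin.
Qed.

Lemma sum_sqr_ge_uniq (R : realType) (n : nat) (y : 'I_n -> R) (s : seq 'I_n) :
  uniq s -> \sum_(i <- s) y i ^+ 2 <= \sum_(i : 'I_n) y i ^+ 2.
Proof.
move=> us; rewrite big_uniq//= [leRHS](bigID (mem s)) /= lerDl.
by apply: sumr_ge0 => i _; exact: sqr_ge0.
Qed.

(* With m the midpoint of y i and y j, put u = (y k - y l) / 2 and
   v = (y k + y l) / 2 - m, so that the right-hand side is
   2 sin (D / 2 - u) cos v. For four distinct nodes the energy bound gives
   2 u^2 + v^2 <= s^2; coincidences among the nodes are treated separately. *)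
Lemma extremal_pair_bound (R : realType) (n : nat) (y : 'I_n -> R) (D s : R)
    (i j k l : 'I_n) :
  0 < D -> D <= pi / 2 -> 0 <= s -> s <= D / 2 ->
  \sum_(i : 'I_n) y i ^+ 2 <= s ^+ 2 + D ^+ 2 / 2 ->
  (forall i j, y i - y j <= D) -> y i - y j = D -> k != i -> l != j ->
  2 * sin (D / 2 - s) <= sin (y i - y k) + sin (y l - y j).
Proof.
move=> D0 Dp s0 sD Es sp ijD ki lj; have hp := pi_gt0 R.
have ij : i != j by apply/eqP => ij; move: ijD; rewrite ij subrr; lra.
pose m := (y i + y j) / 2.
have Ei : y i = m + D / 2 by rewrite /m; lra.
have Ej : y j = m - D / 2 by rewrite /m; lra.
(* The constant 2 / 3 comes from completing the square: 2 m^2 + (m + x)^2 = 3 (m + x / 3)^2 + 2 x^2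
   / 3 with x = y z - m. *)
have triple z : z != i -> z != j -> 2 / 3 * (y z - m) ^+ 2 <= s ^+ 2.
  move=> zi zj; have := @sum_sqr_ge_uniq _ _ y [:: i; j; z].
  rewrite /= !inE !negb_or ij ![_ == z]eq_sym zi zj => /(_ isT).
  rewrite !big_cons big_nil Ei Ej => h.
  by have := sqr_ge0 (m + (y z - m) / 3); lra.
have rng z : m - D / 2 <= y z <= m + D / 2.
  by have := sp z j; have := sp i z; rewrite Ei Ej; lra.
have [kl|kl] := eqVneq k l.
  rewrite -kl in lj *; rewrite sinDsin.
  have -> : (y i - y k + (y k - y j)) / 2 = D / 2 by lra.
  have -> : (y i - y k - (y k - y j)) / 2 = m - y k by rewrite Ei Ej; lra.
  rewrite ler_pM2l// sin_lower_common//.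
  by have := triple k ki lj; rewrite -sqrrN opprB.
(* If [k] is [j] or [l] is [i], one sine is sin D. It is at least sin (D / 2 + x), and the sum with
   sin (D / 2 - x) is then 2 sin (D / 2) cos x, as for a common neighbour. *)
have common x : - (D / 2) <= x <= D / 2 -> 2 / 3 * x ^+ 2 <= s ^+ 2 ->
    2 * sin (D / 2 - s) <= sin (D / 2 - x) + sin D.
  move=> rx tx; have h := sin_lower_common s0 sD Dp tx.
  apply: (@le_trans _ _ (sin (D / 2 - x) + sin (D / 2 + x))).
    by rewrite [X in _ <= X + _]sinB [X in _ <= _ + X]sinD; lra.
  by rewrite lerD2l ler_sin ?in_itv /=; lra.
have [kj|kj] := eqVneq k j.
  rewrite kj ijD; have [li|li] := eqVneq l i.
    rewrite li ijD.
    have : sin (D / 2 - s) <= sin D by rewrite ler_sin ?in_itv /=; lra.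
    lra.
  have := common (m - y l); rewrite (_ : D / 2 - (m - y l) = y l - y j); last by rewrite Ej; lra.
  move=> h; rewrite [leRHS]addrC; apply: h; first by have := rng l; lra.
  by rewrite -sqrrN opprB; exact: triple.
have [li|li] := eqVneq l i.
  rewrite li ijD; have := common (y k - m).
  rewrite (_ : D / 2 - (y k - m) = y i - y k); last by rewrite Ei; lra.
  apply; [by have := rng k; lra | exact: triple].
rewrite sinDsin ler_pM2l//.
pose u := (y k - y l) / 2; pose v := (y k + y l) / 2 - m.
have -> : (y i - y k + (y l - y j)) / 2 = D / 2 - u by rewrite /u; lra.
have -> : (y i - y k - (y l - y j)) / 2 = - v by rewrite /v Ei Ej; lra.
rewrite cosN sin_lower_distinct//.
(* The four squares sum to D^2 / 2 + (2 m + v)^2 + v^2 + 2 u^2. *)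
have := @sum_sqr_ge_uniq _ _ y [:: i; j; k; l].
rewrite /= !inE !negb_or ij kl ![i == _]eq_sym ![j == _]eq_sym ki kj li lj => /(_ isT).
rewrite !big_cons big_nil Ei Ej => h.
have := sqr_ge0 (2 * m + v); rewrite /u /v; lra.
Qed.

(** All nodes lie between the phases of [j] and [i], so every coupling term pulls these two
    together. Each sum is at least the minimum degree times its weakest term, and
    [extremal_pair_bound] compares the two weakest terms with the drift. *)
Lemma rhs_extremal (R : realType) (n : nat) (e : rel 'I_n) (K : R)
    (w y : 'I_n -> R) (D E0 : R) (i j : 'I_n) :
  simple_graph e -> connected_graph e -> (1 < n)%N -> 0 < K ->
  0 < D -> D <= pi / 2 ->
  ((E0 < 3 / 4 * D ^+ 2 /\
    (forall i j : 'I_n,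
       K >= n%:R * `|w i - w j| /
              (2 * (min_degree e)%:R * sin (D / 2 - Num.sqrt (E0 - D ^+ 2 / 2)))))
   \/ E0 < D ^+ 2 / 2) ->
  \sum_(i : 'I_n) y i ^+ 2 <= E0 ->
  (forall i j, y i - y j <= D) -> y i - y j = D ->
  kuramoto_rhs e K w y i <= kuramoto_rhs e K w y j.
Proof.
move=> [eC e0] ce n1 K0 D0 Dp hE yE sp ijD; have hp := pi_gt0 R.
have ij : i != j by apply/eqP => ij; move: ijD; rewrite ij subrr; lra.
(* Two phases at distance [D] already carry energy D^2 / 2, which excludes the second alternative of
   the hypothesis. *)
have DE : D ^+ 2 / 2 <= E0.
  apply: le_trans yE; have := @sum_sqr_ge_uniq _ _ y [:: i; j].
  rewrite /= !inE ij => /(_ isT); rewrite !big_cons big_nil -ijD => h.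
  by have := sqr_ge0 (y i + y j); lra.
case: hE => [[E34 hK]|]; last by rewrite ltNge DE.
move: hK; set s := Num.sqrt _ => hK.
have s0 : 0 <= s by exact: sqrtr_ge0.
have s2 : s ^+ 2 = E0 - D ^+ 2 / 2 by rewrite sqr_sqrtr ?subr_ge0.
(* This is exactly E0 < 3 D^2 / 4, and it makes the sine in the denominator positive. *)
have sD : s < D / 2.
  rewrite -(ltr_pXn2r (_ : 0 < 2)%N) ?nnegrE ?s2//; last lra.
  by rewrite exprMn; lra.
have rng k : 0 <= y i - y k /\ 0 <= y k - y j.
  by have := sp k j; have := sp i k; lra.
have f0 k : e i k -> 0 <= sin (y i - y k).
  by move=> _; have := sp i k; have [? ?] := rng k; move=> ?; apply: sin_ge0_pi; lra.
have g0 k : e j k -> 0 <= sin (y k - y j).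
  by move=> _; have := sp k j; have [? ?] := rng k; move=> ?; apply: sin_ge0_pi; lra.
have [k ik hk] := min_degree_sum ce n1 f0.
have [l jl hl] := min_degree_sum ce n1 g0.
have ki : k != i by apply/eqP => ki; rewrite ki e0 in ik.
have lj : l != j by apply/eqP => lj; rewrite lj e0 in jl.
have h : 2 * sin (D / 2 - s) <= sin (y i - y k) + sin (y l - y j).
  by apply: extremal_pair_bound (ltW sD) _ sp ijD ki lj => //; rewrite s2; lra.
have d0 := min_degree_gt0 ce n1.
have S0 : 0 < sin (D / 2 - s) by apply: sin_gt0_pi; lra.
have n0 : 0 < n%:R :> R by rewrite ltr0n ltnW.
have := hK i j; rewrite ler_pdivrMr ?mulr_gt0 ?ltr0n// => hw.
have wij := ler_norm (w i - w j).
rewrite /kuramoto_rhs.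
under eq_bigr do rewrite -opprB sinN.
rewrite sumrN.
set F := \sum_(k | e i k) _ in hk *; set G := \sum_(k | e j k) _ in hl *.
set d : R := (min_degree e)%:R in hk hl hw *.
have h2 : d * (2 * sin (D / 2 - s)) <= F + G.
  have := ler_wpM2l (ler0n R (min_degree e)) h; rewrite -/d; lra.
have h3 : n%:R * (w i - w j) <= K * (F + G).
  apply: (@le_trans _ _ (n%:R * `|w i - w j|)); first by rewrite ler_pM2l.
  by apply: le_trans hw _; have := ler_wpM2l (ltW K0) h2; lra.
rewrite -(ler_pM2l n0).
have e1 x : n%:R * (K / n%:R * x) = K * x by field; rewrite gt_eqF.
by rewrite !mulrDr !e1; lra.
Qed.

(** The squares (B a_i - C b_i)^2 sum to B (A B - C^2), which settles B > 0; for B = 0 every b_i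
    vanishes. *)
Lemma cauchy_schwarz_sum (R : realType) (n : nat) (a b : 'I_n -> R) :
  \sum_(i : 'I_n) a i * b i <=
  Num.sqrt (\sum_(i : 'I_n) a i ^+ 2) * Num.sqrt (\sum_(i : 'I_n) b i ^+ 2).
Proof.
set A := \sum_(i : 'I_n) a i ^+ 2; set B := \sum_(i : 'I_n) b i ^+ 2.
set C := \sum_(i : 'I_n) _.
have A0 : 0 <= A by apply: sumr_ge0 => i _; exact: sqr_ge0.
have B0 : 0 <= B by apply: sumr_ge0 => i _; exact: sqr_ge0.
rewrite -sqrtrM//; apply: le_trans (ler_norm C) _.
rewrite -sqrtr_sqr ler_wsqrtr//.
have hq : 0 <= B * (A * B - C ^+ 2).
  have -> : B * (A * B - C ^+ 2) = \sum_(i : 'I_n) (B * a i - C * b i) ^+ 2.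
    have h i : (B * a i - C * b i) ^+ 2 =
       B ^+ 2 * a i ^+ 2 - (2 * B * C) * (a i * b i) + C ^+ 2 * b i ^+ 2 by ring.
    under eq_bigr do rewrite h.
    rewrite big_split /= sumrB -!mulr_sumr -/A -/B -/C; ring.
  by apply: sumr_ge0 => i _; exact: sqr_ge0.
have [Bp|Bn] := ltP 0 B; first by move: hq; rewrite pmulr_rge0// subr_ge0.
have Bz : B = 0 by apply/eqP; rewrite eq_le Bn B0.
have bz i : b i = 0.
  apply/eqP; rewrite -sqrf_eq0; move/eqP: Bz; rewrite /B psumr_eq0 => [|? _]; last exact: sqr_ge0.
  by move/allP/(_ i (mem_index_enum i)).
rewrite /C big1 ?expr0n ?mulr_ge0// => i _; by rewrite bz mulr0.
Qed.

(** The sum is half the rate of change of the energy. The dissipation is K T / (2 n), and T >= Q sin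
    D / D >= 2 n L E sin D / D, so the bound on [K] makes it at least sigma sqrt E. *)
Lemma rhs_radial (R : realType) (n : nat) (e : rel 'I_n) (K : R)
    (w y : 'I_n -> R) (D : R) :
  simple_graph e -> connected_graph e -> (1 < n)%N -> 0 < K ->
  0 < D -> D <= pi / 2 ->
  let E := \sum_(i : 'I_n) y i ^+ 2 in 0 < E ->
  K >= Num.sqrt (\sum_(i : 'I_n) w i ^+ 2) * D / (Num.sqrt E * L_const R e * sin D) ->
  \sum_(i : 'I_n) y i = 0 -> (forall i j, y i - y j <= D) ->
  \sum_(i : 'I_n) y i * kuramoto_rhs e K w y i <= 0.
Proof.
move=> sg ce n1 K0 D0 Dp E E0; set sg' := Num.sqrt (\sum_i w i ^+ 2); set L := L_const R e.
move=> hK y0 sp; have hp := pi_gt0 R.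
have n0 : 0 < n%:R :> R by rewrite ltr0n ltnW.
have L0 : 0 < L.
  rewrite /L /L_const div1r invr_gt0; apply: (@lt_le_trans _ _ 1) => //.
  by rewrite lerDl; apply: sumr_ge0 => k _; apply: sumr_ge0 => l _; exact: ler0n.
have sD : 0 < sin D by apply: sin_gt0_pi; lra.
have q0 : 0 < Num.sqrt E by rewrite sqrtr_gt0.
have qq : Num.sqrt E ^+ 2 = E by rewrite sqr_sqrtr// ltW.
move: hK; rewrite (ler_pdivrMr _ _ (mulr_gt0 (mulr_gt0 q0 L0) sD)) => hK.
have CS := cauchy_schwarz_sum y w; rewrite -/E -/sg' in CS.
have edge := edge_energy_ge sg ce y0; rewrite -/L -/E in edge.
set Q := \sum_(u : 'I_n) \sum_(v : 'I_n | e u v) (y u - y v) ^+ 2 in edge.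
set T := \sum_(u : 'I_n) \sum_(v : 'I_n | e u v) ((y u - y v) * sin (y u - y v)).
have QT : Q * sin D <= D * T.
  rewrite /Q /T mulr_suml mulr_sumr; apply: ler_sum => u _.
  rewrite mulr_suml mulr_sumr; apply: ler_sum => v _.
  apply: mul_sin_ge => //; rewrite ler_norml sp andbT lerNl opprB; exact: sp.
(* Summation by parts: the sum is written twice, with the ends of each edge exchanged, and the two
   forms are added. *)
have key : \sum_(i : 'I_n) y i * (\sum_(k : 'I_n | e i k) sin (y k - y i)) = - T / 2.
  set X := LHS.
  have X1 : X = \sum_u \sum_(v | e u v) y u * sin (y v - y u).
    by apply: eq_bigr => u _; rewrite mulr_sumr.
  have X2 : X = \sum_u \sum_(v | e u v) y v * sin (y u - y v).
    rewrite X1 (exchange_big_dep predT) //=; apply: eq_bigr => u _.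
    by apply: eq_bigl => v; case: sg => ->.
  suff : X + X = - T by lra.
  rewrite {1}X1 X2 -big_split /T -sumrN; apply: eq_bigr => u _ /=.
  rewrite -big_split -sumrN; apply: eq_bigr => v _ /=.
  by rewrite -[y v - y u]opprB sinN; ring.
have -> : \sum_i y i * kuramoto_rhs e K w y i =
    \sum_i y i * w i + K / n%:R * (- T / 2).
  rewrite -key mulr_sumr -big_split /=; apply: eq_bigr => i _.
  by rewrite /kuramoto_rhs; ring.
suff h : Num.sqrt E * sg' <= K / n%:R * (T / 2) by lra.
have nD : 0 < n%:R * D by rewrite mulr_gt0.
rewrite -(ler_pM2l nD).
have -> : n%:R * D * (K / n%:R * (T / 2)) = K * (D * T) / 2 by field; rewrite gt_eqF.
have h1 := ler_wpM2l (ltW K0) QT.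
have h2 := ler_wpM2r (ltW sD) edge; have h3 := ler_wpM2l (ltW K0) h2.
have h4 : n%:R * Num.sqrt E * (sg' * D) <= n%:R * Num.sqrt E * (K * (Num.sqrt E * L * sin D)).
  by rewrite ler_wpM2l// mulr_ge0// ltW.
have h5 : n%:R * Num.sqrt E * (K * (Num.sqrt E * L * sin D)) =
    K * (n%:R * L * Num.sqrt E ^+ 2 * sin D) by ring.
rewrite qq in h5.
lra.
Qed.

(** * A comparison principle *)

Lemma derivable_continuous1 (R : realType) (f : R -> R) (t df : R) :
  is_derive t 1 f df -> {for t, continuous f}.
Proof.
by move=> [dr _]; apply/differentiable_continuous; rewrite -derivable1_diffP.
Qed.

(** Solutions are differentiable only at positive times; right continuity at 0 lets the interval
    start there. *)
Lemma MVT_right (R : realType) (f df : R -> R) (a b : R) :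
  (f x @[x --> 0^'+] --> f 0)%classic ->
  (forall t : R, 0 < t -> is_derive t 1 f (df t)) ->
  0 <= a -> a < b ->
  exists2 c, a < c < b & f b - f a = df c * (b - a).
Proof.
move=> f0 fd a0 ab; have [||c] := @MVT R f df a b ab.
- by move=> x; rewrite in_itv /= => /andP[ax _]; apply: fd; exact: le_lt_trans ax.
- have ct x : 0 < x -> {for x, continuous f}.
    by move=> /fd; exact: derivable_continuous1.
  apply/continuous_within_itvP => //; split.
  + by move=> x; rewrite in_itv /= => /andP[ax _]; apply: ct; exact: le_lt_trans ax.
  + move: a0; rewrite le_eqVlt => /predU1P[<-//|a0].
    by apply: cvg_at_right_filter; exact: ct.
  + by apply: cvg_at_left_filter; apply: ct; exact: le_lt_trans ab.
- by rewrite in_itv /=; exists c.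
Qed.

Lemma derive_lt0_left (R : realType) (f : R -> R) (t df : R) :
  is_derive t 1 f df -> df < 0 -> 0 < t -> exists2 s, 0 < s < t & f t < f s.
Proof.
move=> [dr <-] df0 t0.
have [d /= d0 hd] := cvgr_lt _ dr _ df0.
pose h := - (Num.min d t / 2).
have m0 : 0 < Num.min d t by rewrite lt_min d0 t0.
have md : Num.min d t <= d by rewrite ge_min lexx.
have mt : Num.min d t <= t by rewrite ge_min lexx orbT.
have h0 : h < 0 by rewrite /h; lra.
have hd' : `|0 - h| < d by rewrite sub0r normrN ltr0_norm// /h; lra.
have hq : h^-1 * (f (h * 1 + t) - f t) < 0 by apply: (hd h hd'); rewrite lt_eqF.
exists (h + t); first by rewrite /h; apply/andP; split; lra.
by move: hq; rewrite mulr1 nmulr_rlt0 ?invr_lt0// subr_gt0.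
Qed.

(** At the first time [T] when some component is nonnegative, all components are at most 0 and one
    is 0. Its negative derivative would make it positive just before [T], contradicting
    minimality. *)
Lemma barrier (R : realType) (I : finType) (f df : I -> R -> R) :
  (forall a, (f a x @[x --> 0^'+] --> f a 0)%classic) ->
  (forall a (t : R), 0 < t -> is_derive t 1 (f a) (df a t)) ->
  (forall a, f a 0 < 0) ->
  (forall a (t : R), 0 < t -> (forall b, f b t <= 0) -> f a t = 0 -> df a t < 0) ->
  forall a t, 0 <= t -> f a t < 0.
Proof.
move=> f0 fd finit fbar a1 t1 t10; rewrite ltNge; apply/negP => ft1.
pose B := [set t : R | 0 <= t /\ exists a, 0 <= f a t]%classic.
have Blb : lbound B 0 by move=> t [].
have Binf : has_inf B by split; [exists t1; split => //; exists a1 | exists 0].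
set T := inf B.
have T0 : 0 <= T by apply: lb_le_inf => //; case: Binf.
have before s : 0 <= s -> s < T -> forall a, f a s < 0.
  move=> s0 sT a; rewrite ltNge; apply/negP => fs.
  suff : T <= s by rewrite leNgt sT.
  by apply: ge_inf; [exists 0 | split => //; exists a].
have ct a x : 0 < x -> {for x, continuous (f a)}.
  by move=> /(fd a); exact: derivable_continuous1.
have TB : exists a, 0 <= f a T.
  apply: contrapT => nT.
  have neg a : f a T < 0.
    by rewrite ltNge; apply/negP => h; apply: nT; exists a.
  have rc a : (f a x @[x --> T^'+] --> f a T)%classic.
    move: T0; rewrite le_eqVlt => /predU1P[<-//|T0].
    by apply: cvg_at_right_filter; exact: ct.
  (* Finiteness of [I] gives one right neighbourhood valid for all components, so the infimum is
     attained. *)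
  have : (\forall x \near T^'+, forall a, f a x < 0)%classic.
    by apply: filter_forall => a; exact: cvgr_lt _ (rc a) _ (neg a).
  move=> [d /= d0 hd].
  have [x [x0 [a fx]] xd] := inf_adherent d0 Binf.
  have Tx : T <= x by apply: ge_inf; [exists 0 | split => //; exists a].
  have {Tx}: x = T \/ T < x by move: Tx; rewrite le_eqVlt => /predU1P[->|]; [left|right].
  case=> [xT|Tx]; first by move: fx; rewrite xT leNgt neg.
  have := hd x; rewrite /ball_ /= ltr0_norm ?subr_lt0// opprB ltrBlDl => /(_ xd Tx a).
  by rewrite ltNge fx.
have [a fa] := TB.
have Tp : 0 < T.
  rewrite lt_def T0 andbT; apply/eqP => TT; move: fa; rewrite TT leNgt.
  by rewrite finit.
have le0 b : f b T <= 0.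
  rewrite leNgt; apply/negP => fb.
  have [d /= d0 hd] := cvgr_gt _ (ct b T Tp) _ fb.
  pose s := T - Num.min d T / 2.
  have m0 : 0 < Num.min d T by rewrite lt_min d0 Tp.
  have md : Num.min d T <= d by rewrite ge_min lexx.
  have mt : Num.min d T <= T by rewrite ge_min lexx orbT.
  have : 0 < f b s.
    by apply: hd; rewrite /ball_ /= /s opprB addrC subrK gtr0_norm; lra.
  by apply/negP; rewrite -leNgt ltW// before// /s; lra.
have fa0 : f a T = 0 by apply/eqP; rewrite eq_le le0 fa.
have [s /andP[s0 sT]] := derive_lt0_left (fd a T Tp) (fbar a T Tp le0 fa0) Tp.
by rewrite fa0 ltNge ltW// before// ltW.
Qed.

(** * Invariance *)

Lemma cvg_sumr (R : realType) (I : finType) (P : pred I) (T : Type)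
    (F : set_system T) (f : I -> T -> R) (l : I -> R) : Filter F ->
  (forall i, P i -> (f i x @[x --> F] --> l i)%classic) ->
  (\sum_(i | P i) f i x @[x --> F] --> \sum_(i | P i) l i)%classic.
Proof. by move=> FF fl; apply: cvg_big fl; exact: add_continuous. Qed.

Lemma is_derive_sumr (R : realType) (n : nat) (f : 'I_n -> R -> R) (df : 'I_n -> R)
    (t : R) : (forall i, is_derive t 1 (f i) (df i)) ->
  is_derive t 1 (fun s => \sum_(i : 'I_n) f i s) (\sum_(i : 'I_n) df i).
Proof. by move=> h; have := is_derive_sum h; rewrite fct_sumE. Qed.

Lemma is_derive_mulr (R : realType) (f : R -> R) (c t df : R) :
  is_derive t 1 f df -> is_derive t 1 (fun s => c * f s) (c * df).
Proof. exact: is_deriveZ. Qed.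

Lemma is_derive_sqr (R : realType) (f : R -> R) (t df : R) :
  is_derive t 1 f df -> is_derive t 1 (fun s => f s ^+ 2) (2 * f t * df).
Proof.
move=> h; have h2 : is_derive t 1 (fun s => f s ^+ 2) (f t *: df + f t *: df).
  exact: (is_deriveM h h).
by apply: is_derive_eq h2 _; rewrite /GRing.scale /=; ring.
Qed.

(** The coupling terms cancel in pairs: the graph is symmetric and the sine is odd. *)
Lemma sum_rhs (R : realType) (n : nat) (e : rel 'I_n) (K : R) (w y : 'I_n -> R) :
  simple_graph e -> \sum_(i : 'I_n) w i = 0 ->
  \sum_(i : 'I_n) kuramoto_rhs e K w y i = 0.
Proof.
move=> [eC _] w0; rewrite /kuramoto_rhs big_split /= w0 add0r -mulr_sumr.
set S := \sum_(i : 'I_n) _; suff : S = - S by move=> SN; rewrite (_ : S = 0) ?mulr0//; lra.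
rewrite {1}/S (exchange_big_dep predT) //= -sumrN; apply: eq_bigr => i _.
rewrite -sumrN; apply: eq_big => [k|k _]; first by rewrite eC.
by rewrite -sinN opprB.
Qed.

Lemma sum_phase_constant (R : realType) (n : nat) (e : rel 'I_n) (K : R)
    (w : 'I_n -> R) (phi : R -> 'I_n -> R) :
  simple_graph e -> \sum_(i : 'I_n) w i = 0 -> is_solution e K w phi ->
  forall t, 0 <= t -> \sum_(i : 'I_n) phi t i = \sum_(i : 'I_n) phi 0 i.
Proof.
move=> sg w0 [phi0 dphi] t; rewrite le_eqVlt => /predU1P[<-//|t0].
have [c _] := @MVT_right R (fun s => \sum_(i : 'I_n) phi s i)
  (fun s => \sum_(i : 'I_n) kuramoto_rhs e K w (phi s) i) 0 t
  (cvg_sumr _ (fun i _ => phi0 i))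
  (fun s s0 => is_derive_sumr (fun i => dphi s i s0)) (lexx 0) t0.
by rewrite sum_rhs// mul0r => /eqP; rewrite subr_eq0 => /eqP.
Qed.

(** The field depends on phase differences only, and the factor 1 / n absorbs a sum of at most [n]
    neighbour terms. *)
Lemma rhs_lipschitz (R : realType) (n : nat) (e : rel 'I_n) (K : R)
    (w x y : 'I_n -> R) (c : R) (i : 'I_n) : 0 <= K ->
  (forall k, `|(x k - x i) - (y k - y i)| <= c) ->
  `|kuramoto_rhs e K w x i - kuramoto_rhs e K w y i| <= K * c.
Proof.
move=> K0 h; have n0 : 0 < n%:R :> R by rewrite ltr0n (leq_ltn_trans _ (ltn_ord i)).
have c0 : 0 <= c by apply: le_trans (h i).
rewrite /kuramoto_rhs opprD addrACA subrr add0r -mulrBr -sumrB normrM.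
rewrite ger0_norm ?divr_ge0// -mulrA ler_wpM2l// mulrC ler_pdivrMr//.
apply: le_trans (ler_norm_sum _ _ _) _.
rewrite mulr_natr -[n in X in _ <= X]card_ord -sumr_const.
rewrite [leRHS](bigID (e i)) /= -[leLHS]addr0 lerD ?sumr_ge0//.
by apply: ler_sum => k _; apply: le_trans (norm_sinB _ _) (h k).
Qed.

(* At first contact of phi with the boundary of r S, where r = 1 + eps exp(M t),
   the hypotheses apply to y = phi / r, which lies on the boundary of S, and
   rhs(phi) differs from rhs(y) by O(r - 1); M is large enough for r to outrun
   this error. The result follows by letting eps tend to 0. *)
Lemma invariance (R : realType) (n : nat) (e : rel 'I_n) (K : R)
    (w : 'I_n -> R) (phi : R -> 'I_n -> R) (D E0 : R) :
  simple_graph e -> 0 < K -> \sum_(i : 'I_n) w i = 0 -> is_solution e K w phi ->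
  0 < D -> 0 < E0 ->
  (forall y, \sum_(i : 'I_n) y i = 0 -> (forall i j, y i - y j <= D) ->
     \sum_(i : 'I_n) y i ^+ 2 <= E0 -> forall i j, y i - y j = D ->
     kuramoto_rhs e K w y i <= kuramoto_rhs e K w y j) ->
  (forall y, \sum_(i : 'I_n) y i = 0 -> (forall i j, y i - y j <= D) ->
     \sum_(i : 'I_n) y i ^+ 2 = E0 ->
     \sum_(i : 'I_n) y i * kuramoto_rhs e K w y i <= 0) ->
  \sum_(i : 'I_n) phi 0 i = 0 -> (forall i j, phi 0 i - phi 0 j <= D) ->
  \sum_(i : 'I_n) phi 0 i ^+ 2 <= E0 ->
  forall t, 0 <= t -> (forall i j, phi t i - phi t j <= D) /\
    \sum_(i : 'I_n) phi t i ^+ 2 <= E0.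
Proof.
move=> sg K0 w0 sol D0 E00 Hs Hr sum0 sp0 En0.
(* The first term outweighs the error K (r - 1) D made at each of two nodes, the second the error in
   the energy balance; the 1 keeps both comparisons strict. *)
pose M := 2 * K + K * D * (n%:R * (1 + E0)) / E0 + 1.
have c0 : 0 <= K * D * (n%:R * (1 + E0)) by rewrite !mulr_ge0 ?ler0n// ?addr_ge0 ?ltW.
have M2K : 2 * K < M by rewrite /M; have := divr_ge0 c0 (ltW E00); lra.
have ME : K * D * (n%:R * (1 + E0)) < M * E0.
  rewrite /M !mulrDl divfK ?gt_eqF// mul1r.
  by have := mulr_gt0 K0 E00; lra.
pose r eps t : R := 1 + eps * expR (M * t).
(* One finite family holds all constraints: [Some (i, j)] for a phase difference, [None] for the
   energy, which scales by r^2. *)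
pose f eps (a : option ('I_n * 'I_n)) (t : R) : R :=
  if a is Some (i, j) then phi t i - phi t j - r eps t * D
  else \sum_(i : 'I_n) phi t i ^+ 2 - r eps t ^+ 2 * E0.
pose F t i := kuramoto_rhs e K w (phi t) i.
pose df eps (a : option ('I_n * 'I_n)) (t : R) : R :=
  if a is Some (i, j) then F t i - F t j - (r eps t - 1) * M * D
  else \sum_(i : 'I_n) 2 * phi t i * F t i - 2 * r eps t * ((r eps t - 1) * M) * E0.
have main eps : 0 < eps -> forall a t, 0 <= t -> f eps a t < 0.
  move=> eps0.
  have r1 t : 1 < r eps t by rewrite /r ltrDl mulr_gt0// expR_gt0.
  have dr (t : R) : is_derive t 1 (r eps) ((r eps t - 1) * M).
    have dl : is_derive t 1 (fun s => M * s) (M * 1) by exact: is_derive_mulr.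
    have de := is_derive_mulr eps (is_derive1_comp (is_derive_expR (M * t)) dl).
    have := is_deriveD (is_derive_cst (1 : R) t (1 : R)) de.
    by move/is_derive_eq; apply; rewrite /r; ring.
  have cr : (r eps x @[x --> 0^'+] --> r eps 0)%classic.
    by apply: cvg_at_right_filter; exact: derivable_continuous1 (dr 0).
  case: (sol) => phi0 dphi.
  apply: (@barrier _ _ (f eps) (df eps)).
  - move=> [[i j]|] /=.
      by apply: cvgB; [apply: cvgB; exact: phi0 | apply: cvgM => //; exact: cvg_cst].
    apply: cvgB; last by apply: cvgM; [apply: cvgM | exact: cvg_cst].
    by apply: cvg_sumr => i _; apply: cvgM; exact: phi0.
  - move=> [[i j]|] t t0.
      have h := is_deriveB (is_deriveB (dphi t i t0) (dphi t j t0)) (is_derive_mulr D (dr t)).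
      have fE : f eps (Some (i, j)) = (fun s => phi s i) - (fun s => phi s j) - (fun s => D * r eps s).
        by apply/funext => s; rewrite /f [r eps s * D]mulrC.
      by rewrite fE; apply: is_derive_eq h _; rewrite /df /F; ring.
    have h := is_deriveB (is_derive_sumr (fun i => is_derive_sqr (dphi t i t0)))
      (is_derive_mulr E0 (is_derive_sqr (dr t))).
    have fE : f eps None = (fun s => \sum_(i : 'I_n) phi s i ^+ 2) - (fun s => E0 * r eps s ^+ 2).
      by apply/funext => s; rewrite /f [_ * E0]mulrC.
    by rewrite fE; apply: is_derive_eq h _; rewrite /df /F; ring.
  - have r0 := r1 0; move=> [[i j]|] /=.
      have := sp0 i j; have : D < r eps 0 * D by rewrite ltr_pMl.
      lra.
    have : E0 < r eps 0 ^+ 2 * E0 by rewrite ltr_pMl// exprn_egt1.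
    lra.
  - move=> a t t0 le0; have r1t := r1 t; set rt := r eps t in r1t *.
    have rt0 : 0 < rt by lra.
    pose y i := phi t i / rt.
    have phiE i : phi t i = rt * y i by rewrite /y mulrC divfK// gt_eqF.
    have ysum : \sum_(i : 'I_n) y i = 0.
      by rewrite /y -mulr_suml (sum_phase_constant sg w0 sol (ltW t0)) sum0 mul0r.
    have ysp i j : y i - y j <= D.
      have := le0 (Some (i, j)); rewrite /= -/rt !phiE -mulrBr subr_le0.
      by rewrite ler_pM2l.
    have yE2 : \sum_(i : 'I_n) phi t i ^+ 2 = rt ^+ 2 * \sum_(i : 'I_n) y i ^+ 2.
      by rewrite mulr_sumr; apply: eq_bigr => i _; rewrite phiE exprMn.
    have yE : \sum_(i : 'I_n) y i ^+ 2 <= E0.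
      by have := le0 None; rewrite /= -/rt yE2 -mulrBr pmulr_rle0 ?exprn_gt0// subr_le0.
    have lip i : `|F t i - kuramoto_rhs e K w y i| <= K * ((rt - 1) * D).
      apply: rhs_lipschitz (ltW K0) _ => k.
      have -> : phi t k - phi t i - (y k - y i) = (rt - 1) * (y k - y i).
        by rewrite !phiE; ring.
      rewrite normrM gtr0_norm; last lra.
      apply: ler_wpM2l; first lra.
      by rewrite ler_norml ysp andbT lerNl opprB.
    have rM : (rt - 1) * (2 * K) < (rt - 1) * M by rewrite ltr_pM2l; lra.
    case: a => [[i j]|] /=; rewrite -/rt => /eqP.
      rewrite subr_eq0 !phiE -mulrBr => /eqP/(mulfI (lt0r_neq0 rt0)) yD.
      have := Hs y ysum ysp yE i j yD.
      have := lip i; have := lip j; rewrite !ler_norml => /andP[? ?] /andP[? ?] ?.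
      have : (rt - 1) * (2 * K) * D < (rt - 1) * M * D by rewrite ltr_pM2r.
      lra.
    rewrite yE2 subr_eq0 => /eqP/(mulfI (lt0r_neq0 (exprn_gt0 2 rt0))) yEE.
    have yr := Hr y ysum ysp yEE.
    (* From 2 |y| <= 1 + y^2. *)
    have yb i : `|y i| <= 1 + E0.
      have : y i ^+ 2 <= E0.
        by rewrite -yEE (bigD1 i) //= lerDl sumr_ge0// => k _; exact: sqr_ge0.
      rewrite -[y i ^+ 2]real_normK ?num_real//.
      by have := sqr_ge0 (`|y i| - 1); lra.
    have h1 : \sum_(i : 'I_n) y i * F t i <= n%:R * (1 + E0) * (K * ((rt - 1) * D)).
      have -> : \sum_(i : 'I_n) y i * F t i = \sum_(i : 'I_n) y i * kuramoto_rhs e K w y i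
          + \sum_(i : 'I_n) y i * (F t i - kuramoto_rhs e K w y i).
        by rewrite -big_split /=; apply: eq_bigr => i _; ring.
      rewrite -[leRHS]add0r lerD//.
      rewrite -mulrA mulr_natl -[n in X in _ <= X]card_ord -sumr_const; apply: ler_sum => i _.
      by apply: le_trans (ler_norm _) _; rewrite normrM ler_pM.
    have -> : \sum_(i : 'I_n) 2 * phi t i * F t i = 2 * rt * \sum_(i : 'I_n) y i * F t i.
      by rewrite mulr_sumr; apply: eq_bigr => i _; rewrite phiE; ring.
    rewrite -!mulrA -mulrBr pmulr_rlt0// -mulrBr pmulr_rlt0//.
    have : (rt - 1) * (K * D * (n%:R * (1 + E0))) < (rt - 1) * (M * E0).
      by rewrite ltr_pM2l//; lra.
    lra.
move=> t t0.
have X0 : 0 < expR (M * t) by exact: expR_gt0.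
(* In place of a limit, [eps] is tuned so that the enlargement at time [t] is exactly 1 + c, with
   [c] read off from the supposed excess. *)
have rE c : r (c / expR (M * t)) t = 1 + c by rewrite /r divfK// gt_eqF.
split=> [i j|].
  rewrite leNgt; apply/negP => h.
  pose c := (phi t i - phi t j - D) / D.
  have cp : 0 < c by rewrite divr_gt0// subr_gt0.
  have := main (c / expR (M * t)) (divr_gt0 cp X0) (Some (i, j)) t t0.
  rewrite /= rE mulrDl mul1r /c divfK ?gt_eqF//; lra.
rewrite leNgt; apply/negP => h; set E := \sum_(i : 'I_n) _ in h.
(* As c <= 1, (1 + c)^2 <= 1 + 3 c, hence (1 + c)^2 E0 <= E. *)
pose c := Num.min 1 ((E - E0) / (3 * E0)).
have cp : 0 < c by rewrite lt_min ltr01 divr_gt0// ?subr_gt0// mulr_gt0.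
have c1 : c <= 1 by rewrite ge_min lexx.
have cE : c * (3 * E0) <= E - E0.
  by rewrite -ler_pdivlMr ?mulr_gt0// ge_min lexx orbT.
have := main (c / expR (M * t)) (divr_gt0 cp X0) None t t0.
rewrite /= rE -/E.
have : c ^+ 2 <= c by rewrite expr2 ler_piMl// ltW.
move=> c2; have := ler_wpM2r (ltW E00) c2; lra.
Qed.

(** * Convergence to equilibria *)

(** For a symmetric graph the velocity field is minus the gradient of this function. The factor 1 /
    2 compensates for the two orientations of each edge. *)
Definition potential (R : realType) (n : nat) (e : rel 'I_n) (K : R)
    (w x : 'I_n -> R) : R :=
  - \sum_(i : 'I_n) w i * x i -
  K / n%:R / 2 * \sum_(i : 'I_n) \sum_(k : 'I_n) (e i k)%:R * cos (x k - x i).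

Lemma is_derive_potential (R : realType) (n : nat) (e : rel 'I_n) (K : R)
    (w : 'I_n -> R) (phi : R -> 'I_n -> R) (t : R) :
  simple_graph e -> is_solution e K w phi -> 0 < t ->
  is_derive t 1 (fun s => potential e K w (phi s))
    (- \sum_(i : 'I_n) kuramoto_rhs e K w (phi t) i ^+ 2).
Proof.
move=> [eC _] [_ dphi] t0; pose F i := kuramoto_rhs e K w (phi t) i.
have dc i k : is_derive t 1 (fun s => (e i k)%:R * cos (phi s k - phi s i))
    ((e i k)%:R * (- sin (phi t k - phi t i) * (F k - F i))).
  apply: is_derive_mulr.
  exact: (is_derive1_comp (is_derive_cos _) (is_deriveB (dphi t k t0) (dphi t i t0))).
have h := is_deriveB
  (is_deriveN (is_derive_sumr (fun i => is_derive_mulr (w i) (dphi t i t0))))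
  (is_derive_mulr (K / n%:R / 2) (is_derive_sumr (fun i => is_derive_sumr (dc i)))).
apply: is_derive_eq h _; rewrite -/F.
pose s i k := (e i k)%:R * sin (phi t k - phi t i).
have FE i : F i = w i + K / n%:R * \sum_(k : 'I_n) s i k.
  rewrite /F /kuramoto_rhs big_mkcond; congr (_ + _ * _); apply: eq_bigr => k _.
  by rewrite /s mulr_natl mulrb.
have -> : \sum_(i : 'I_n) \sum_(k : 'I_n) (e i k)%:R * (- sin (phi t k - phi t i) * (F k - F i))
    = 2 * \sum_(i : 'I_n) F i * \sum_(k : 'I_n) s i k.
  (* [X1] and [X2] attribute each edge term to its two ends; their sum collects the differences of
     velocities. *)
  set X := \sum_(i : 'I_n) F i * _.
  have X1 : X = \sum_(i : 'I_n) \sum_(k : 'I_n) F i * s i k.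
    by apply: eq_bigr => i _; rewrite mulr_sumr.
  have X2 : X = \sum_(i : 'I_n) \sum_(k : 'I_n) - (F k * s i k).
    rewrite X1 exchange_big /=; apply: eq_bigr => i _; apply: eq_bigr => k _.
    by rewrite /s eC -[phi t i - _]opprB sinN; ring.
  have -> : 2 * X = X + X by ring.
  rewrite {1}X1 X2 -big_split; apply: eq_bigr => i _ /=.
  by rewrite -big_split; apply: eq_bigr => k _ /=; rewrite /s; ring.
have -> : \sum_(i : 'I_n) F i ^+ 2 =
    \sum_(i : 'I_n) w i * F i + K / n%:R * \sum_(i : 'I_n) F i * \sum_(k : 'I_n) s i k.
  by rewrite mulr_sumr -big_split; apply: eq_bigr => i _ /=; rewrite expr2 {1}FE; ring.
lra.
Qed.

Lemma potential_lower_bound (R : realType) (n : nat) (e : rel 'I_n) (K : R)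
    (w : 'I_n -> R) (B : R) : 0 <= K ->
  exists m, forall x, (forall i, `|x i| <= B) -> m <= potential e K w x.
Proof.
move=> K0; exists (- \sum_(i : 'I_n) `|w i| * B -
  K / n%:R / 2 * \sum_(i : 'I_n) \sum_(k : 'I_n) 1) => x xB.
rewrite /potential lerB//.
  rewrite lerN2; apply: ler_sum => i _; apply: le_trans (ler_norm _) _.
  by rewrite normrM ler_wpM2l.
rewrite ler_wpM2l ?divr_ge0//; apply: ler_sum => i _; apply: ler_sum => k _.
by case: (e i k); rewrite ?mul1r ?cos_le1 ?mul0r.
Qed.

Lemma norm_rhs_le (R : realType) (n : nat) (e : rel 'I_n) (K : R)
    (w x : 'I_n -> R) (i : 'I_n) : 0 <= K ->
  `|kuramoto_rhs e K w x i| <= \sum_(j : 'I_n) `|w j| + K.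
Proof.
move=> K0; have n0 : 0 < n%:R :> R by rewrite ltr0n (leq_ltn_trans _ (ltn_ord i)).
apply: le_trans (ler_normD _ _) _; apply: lerD.
  by rewrite (bigD1 i) //= lerDl sumr_ge0.
rewrite normrM ger0_norm ?divr_ge0// -mulrA ler_piMr// mulrC ler_pdivrMr// mul1r.
apply: le_trans (ler_norm_sum _ _ _) _.
rewrite -[n in X in _ <= X]card_ord -sumr_const.
rewrite [leRHS](bigID (e i)) /= -[leLHS]addr0 lerD ?sumr_ge0//.
by apply: ler_sum => k _; rewrite ler_norml sin_geN1 sin_le1.
Qed.

(* Barbalat's argument: over a window of fixed length the potential drops by at
   least a multiple of the squared velocity at its left end, since the velocity
   is Lipschitz in time; but it is bounded below. *)
Lemma rhs_vanishes (R : realType) (n : nat) (e : rel 'I_n) (K : R)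
    (w : 'I_n -> R) (phi : R -> 'I_n -> R) (B : R) :
  simple_graph e -> 0 < K -> is_solution e K w phi ->
  (forall t, 0 <= t -> forall i, `|phi t i| <= B) ->
  forall eta, 0 < eta -> exists2 T, 0 < T & forall t, T <= t ->
    \sum_(i : 'I_n) kuramoto_rhs e K w (phi t) i ^+ 2 < eta.
Proof.
move=> sg K0 sol phiB eta eta0.
pose G t := \sum_(i : 'I_n) kuramoto_rhs e K w (phi t) i ^+ 2.
pose P t := potential e K w (phi t).
have G0 t : 0 <= G t by apply: sumr_ge0 => i _; exact: sqr_ge0.
have pos_mvt (f df : R -> R) : (forall t : R, 0 < t -> is_derive t 1 f (df t)) ->
    forall a b, 0 < a -> a < b -> exists2 c, a < c < b & f b - f a = df c * (b - a).
  move=> fd a b a0 ab; have [||c] := @MVT R f df a b ab.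
  - by move=> x; rewrite in_itv /= => /andP[ax _]; apply: fd; exact: lt_trans ax.
  - apply: derivable_within_continuous => x; rewrite in_itv /= => /andP[ax _].
    by have [] := fd x (lt_le_trans a0 ax).
  - by rewrite in_itv /=; exists c.
have Pmvt := pos_mvt P (fun t => - G t) (fun t t0 => is_derive_potential sg sol t0).
have Pdec a b : 0 < a -> a <= b -> P b <= P a.
  move=> a0; rewrite le_eqVlt => /predU1P[->//|ab].
  have [c _ h] := Pmvt a b a0 ab.
  by rewrite -subr_le0 h mulNr oppr_le0 mulr_ge0// subr_ge0 ltW.
have [m mP] := potential_lower_bound e w B (ltW K0).
pose c1 := \sum_(j : 'I_n) `|w j| + K.
have c10 : 0 < c1 by rewrite ltr_wpDl// sumr_ge0.
have phiLip a b i : 0 < a -> a <= b -> `|phi b i - phi a i| <= c1 * (b - a).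
  move=> a0; rewrite le_eqVlt => /predU1P[->|ab]; first by rewrite !subrr normr0 mulr0.
  have [c _ ->] := pos_mvt _ _ (fun t t0 => sol.2 t i t0) a b a0 ab.
  rewrite normrM [`|b - a|]gtr0_norm ?subr_gt0// ler_pM2r ?subr_gt0//.
  exact: norm_rhs_le (ltW K0).
(* Each squared velocity difference factors as (a - b) (a + b): the first factor is at most 2 K c1
   times the elapsed time, the second at most 2 c1. *)
pose c2 := n%:R * (K * (2 * c1) * (2 * c1)).
have c20 : 0 <= c2 by rewrite !mulr_ge0// ltW.
have GLip a b : 0 < a -> a <= b -> G a - G b <= c2 * (b - a).
  move=> a0 ab; rewrite /G -sumrB /c2 -mulrA mulr_natl -[n in X in _ <= X]card_ord -sumr_const.
  apply: ler_sum => i _; rewrite subr_sqr; apply: le_trans (ler_norm _) _.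
  rewrite normrM.
  have -> : K * (2 * c1) * (2 * c1) * (b - a) = K * (2 * c1 * (b - a)) * (2 * c1) by ring.
  apply: ler_pM => //.
    apply: rhs_lipschitz (ltW K0) _ => k.
    have -> : phi a k - phi a i - (phi b k - phi b i) =
      (phi b i - phi a i) - (phi b k - phi a k) by ring.
    apply: le_trans (ler_normB _ _) _.
    by have := phiLip a b i a0 ab; have := phiLip a b k a0 ab; lra.
  apply: le_trans (ler_normD _ _) _.
  have := @norm_rhs_le _ _ e K w (phi a) i (ltW K0).
  have := @norm_rhs_le _ _ e K w (phi b) i (ltW K0); rewrite -/c1; lra.
(* Starting at 1 keeps all times positive, where the solution is differentiable. *)
pose A := [set P t | t in [set t | 1 <= t]]%classic.
have Alb : has_lbound A.
  by exists m => _ [t /= t1 <-]; apply: mP => i; apply: phiB; lra.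
have Ainf : has_inf A by split => //; exists (P 1); exists 1 => /=.
(* Over a window of length [h] the squared velocity loses at most eta / 2; the 1 guards against c2 =
   0. *)
pose h := eta / (2 * (c2 + 1)).
have h0 : 0 < h by rewrite divr_gt0//; lra.
have hc2 : c2 * h <= eta / 2.
  have : h * (2 * (c2 + 1)) = eta by rewrite /h divfK// gt_eqF//; lra.
  lra.
have kap : 0 < h * (eta / 2) by rewrite mulr_gt0//; lra.
(* After [T] the potential can drop by less than h eta / 2, but a squared velocity of [eta] or more
   would force at least that drop within one window. *)
have [_ [T /= T1 <-] PT] := inf_adherent kap Ainf.
exists T; first lra.
move=> t Tt; rewrite -/(G t) ltNge; apply/negP => Gt.
have t0 : 0 < t by lra.
have [c /andP[tc ct]] : exists2 c, t < c < t + h & P (t + h) - P t = - G c * (t + h - t).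
  by apply: Pmvt; lra.
have -> : t + h - t = h by ring.
move=> Pe.
have P1 : P t <= P T by apply: Pdec; lra.
have P2 : inf A <= P (t + h) by apply: ge_inf => //; exists (t + h) => //=; lra.
have G1 := GLip t c t0 (ltW tc).
have G2 : c2 * (c - t) <= c2 * h by rewrite ler_wpM2l//; lra.
have : h * (eta / 2) <= h * G c by rewrite ler_pM2l//; lra.
lra.
Qed.

(** The points of the box at distance at least [eps] from every equilibrium form a compact set [C];
    [eta] is the minimum over [C] of the squared velocity. States become row vectors, whose norm is
    the maximum norm, matching the coordinatewise conclusion. *)
Lemma near_equilibrium (R : realType) (n : nat) (e : rel 'I_n) (K : R)
    (w : 'I_n -> R) (B eps : R) : 0 < eps ->
  exists2 eta, 0 < eta & forall x, (forall i, `|x i| <= B) ->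
    \sum_(i : 'I_n) kuramoto_rhs e K w x i ^+ 2 < eta ->
    exists2 psi, equilibria e K w psi & forall i, `|x i - psi i| < eps.
Proof.
move=> eps0.
pose G (v : 'rV[R]_n) : R := \sum_(i : 'I_n) kuramoto_rhs e K w (v ord0) i ^+ 2.
pose C := ([set v : 'rV[R]_n | forall i, `[- B, B]%classic (v ord0 i)] `&`
  \bigcap_(z in [set z : 'rV[R]_n | equilibria e K w (z ord0)])
    [set v : 'rV[R]_n | eps <= `|v - z|])%classic.
have cG : continuous G.
  move=> v; apply: (@cvg_sumr _ _ _ _ (nbhs v)) => i _.
  have cc k : ((v0 : 'rV[R]_n) ord0 k @[v0 --> v] --> v ord0 k)%classic.
    exact: coord_continuous.
  suff cF : (kuramoto_rhs e K w ((v0 : 'rV[R]_n) ord0) i @[v0 --> v] -->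
      kuramoto_rhs e K w (v ord0) i)%classic by exact: cvgM.
  apply: (@cvgD _ _ _ (nbhs v)); first exact: (@cvg_cst _ (w i) _ (nbhs v) _).
  apply: (@cvgM _ _ (nbhs v)); first exact: (@cvg_cst _ (K / n%:R) _ (nbhs v) _).
  apply: (@cvg_sumr _ _ _ _ (nbhs v)) => k _.
  apply: continuous_cvg; first exact: continuous_sin.
  by apply: (@cvgB _ _ _ (nbhs v)).
have cC : compact C.
  apply: compact_closedI.
    apply: (@rV_compact _ _ (fun=> `[- B, B]%classic)) => i; exact: segment_compact.
  apply: closed_bigI => z _.
  apply: (@preimage_closed _ _ (fun v : 'rV[R]_n => `|v - z|) [set x | eps <= x]%classic).
    move=> v _; apply: (@cvg_norm _ _ _ (nbhs v)).
    by apply: (@cvgB _ _ _ (nbhs v)); [exact: cvg_id | exact: (@cvg_cst _ z _ (nbhs v) _)].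
  exact: closed_ge.
have row (x : 'I_n -> R) : (\row_i x i) ord0 = x by apply/funext => i; rewrite mxE.
have inC x : (forall i, `|x i| <= B) ->
    ~ (exists2 psi, equilibria e K w psi & forall i, `|x i - psi i| < eps) ->
    C (\row_i x i).
  move=> xB nx; split=> [i|z /= ez] /=.
    by rewrite in_itv /= mxE -ler_norml.
  rewrite leNgt; apply/negP => lt; apply: nx; exists (z ord0) => // i.
  apply: le_lt_trans lt; rewrite /Num.norm /= mx_normrE.
  have := le_bigmax 0 (fun ij : 'I_1 * 'I_n => `|(\row_i x i - z) ij.1 ij.2|) (ord0, i).
  by rewrite /= !mxE.
(* If [C] is empty, every point of the box is near an equilibrium and any [eta] works. *)
have [C0|nC] := pselect (C !=set0)%classic; last first.
  exists 1 => // x xB _; apply: contrapT => nx; apply: nC.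
  by exists (\row_i x i); exact: inC.
have [c /set_mem [_ cz] cmin] := compact_EVT_min C0 cC (continuous_subspaceT cG).
have Gc : 0 < G c.
  rewrite lt_def sumr_ge0 ?andbT => [|i _]; last exact: sqr_ge0.
  apply/eqP => Gc.
  (* A zero minimum would make [c] an equilibrium, hence at distance at least [eps] from itself. *)
  suff ceq : equilibria e K w (c ord0).
    have ec : eps <= `|c - c| := cz c ceq.
    by move: ec; rewrite subrr normr0 leNgt eps0.
  move=> i; apply/eqP; rewrite -sqrf_eq0.
  move/eqP: Gc; rewrite psumr_eq0 => [|? _]; last exact: sqr_ge0.
  by move/allP/(_ i (mem_index_enum i)).
exists (G c) => // x xB Gx; apply: contrapT => nx.
have Gr : G (\row_i x i) < G c by rewrite {1}/G row.
by have := cmin _ (mem_set (inC x xB nx)); rewrite leNgt Gr.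
Qed.

(** * The spread of the phases and the assembly of the theorem *)

Lemma le_spread (R : realType) (n : nat) (x : 'I_n -> R) i j : x i - x j <= spread x.
Proof.
have h := le_bigmax 0 (fun i => \big[Num.max/0]_(j : 'I_n) (x i - x j)) i.
exact: le_trans (le_bigmax 0 (fun j => x i - x j) j) h.
Qed.

Lemma spread_le (R : realType) (n : nat) (x : 'I_n -> R) (D : R) : 0 <= D ->
  (forall i j, x i - x j <= D) -> spread x <= D.
Proof.
by move=> D0 xD; apply: bigmax_le => // i _; apply: bigmax_le => // j _.
Qed.

Theorem theorem1 (R : realType) (n : nat) (e : rel 'I_n)
  (K : R) (w : 'I_n -> R) (phi : R -> 'I_n -> R) (D : R) :
  simple_graph e -> connected_graph e ->
  0 < K ->
  \sum_(i : 'I_n) w i = 0 ->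
  is_solution e K w phi ->
  \sum_(i : 'I_n) phi 0 i = 0 ->
  let D0 := spread (phi 0) in
  let E0 := \sum_(i : 'I_n) phi 0 i ^+ 2 in
  let sigma := Num.sqrt (\sum_(i : 'I_n) w i ^+ 2) in
  let L := L_const R e in
  let delta := min_degree e in
  0 < D0 -> D0 <= D -> D <= pi / 2 ->
  K >= sigma * D / (Num.sqrt E0 * L * sin D) ->
  ((E0 < 3 / 4 * D ^+ 2 /\
    (forall i j : 'I_n,
       K >= n%:R * `|w i - w j| /
              (2 * delta%:R * sin (D / 2 - Num.sqrt (E0 - D ^+ 2 / 2)))))
   \/ E0 < D ^+ 2 / 2) ->
  (forall t : R, 0 <= t -> spread (phi t) <= D) /\
  approaches phi (equilibria e K w).
Proof.
move=> sg ce K0 w0 sol sum0 D0 E0 sigma L delta D00 D0D Dp hK hE.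
have D_gt0 : 0 < D by exact: lt_le_trans D0D.
(* A positive initial spread yields two different phases, hence at least two nodes and positive
   energy. *)
have [i0 [j0 ij0]] : exists i j, phi 0 i != phi 0 j.
  apply: contrapT => h; move: D00; rewrite ltNge => /negP; apply.
  apply: spread_le => // i j; rewrite (_ : phi 0 i = phi 0 j) ?subrr//.
  by apply/eqP; apply: contrapT => /negP ij; apply: h; exists i, j.
have n1 : (1 < n)%N.
  have i0j0 : i0 != j0 by apply: contraNneq ij0 => ->.
  rewrite ltnNge; apply: contra i0j0 => n1; apply/eqP/val_inj.
  have z (i : 'I_n) : val i = 0%N.
    by apply/eqP; rewrite -leqn0 -ltnS (leq_trans (ltn_ord i)).
  by rewrite !z.
have E00 : 0 < E0.
  rewrite lt_def sumr_ge0 ?andbT => [|i _]; last exact: sqr_ge0.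
  apply/negP; rewrite psumr_eq0 => [/allP h|? _]; last exact: sqr_ge0.
  have z i : phi 0 i = 0 by apply/eqP; rewrite -sqrf_eq0; exact: h (mem_index_enum i).
  by move: ij0; rewrite !z eqxx.
have inv t : 0 <= t -> (forall i j, phi t i - phi t j <= D) /\
    \sum_(i : 'I_n) phi t i ^+ 2 <= E0.
  apply: (invariance sg K0 w0 sol D_gt0 E00) => // [y _ ysp yE i j yD|y y0 ysp yE|i j].
  - exact: rhs_extremal hE yE ysp yD.
  (* On this face the energy of [y] equals [E0], so the bound on [K] stated for the initial energy
     applies to [y]. *)
  - apply: rhs_radial ysp => //; rewrite yE//.
  - exact: le_trans (le_spread _ _ _) D0D.
split=> [t /inv[sp _]|eps eps0]; first by apply: spread_le => //; exact: ltW.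
have bnd t : 0 <= t -> forall i, `|phi t i| <= 1 + E0.
  move=> /inv[_ Et] i.
  have : phi t i ^+ 2 <= E0.
    by apply: le_trans Et; rewrite (bigD1 i) //= lerDl sumr_ge0// => k _; exact: sqr_ge0.
  rewrite -[phi t i ^+ 2]real_normK ?num_real//.
  by have := sqr_ge0 (`|phi t i| - 1); lra.
have [eta eta0 near] := near_equilibrium e K w (1 + E0) eps0.
have [T T0 van] := rhs_vanishes sg K0 sol bnd eta0.
exists T => t Tt; apply: near (van t Tt); apply: bnd; exact: le_trans (ltW T0) Tt.
Qed.
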